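(* Let $(X,p)$ be a finitely typed generalised partial metric space, equipped with its categorical topology, let $(x_n)_n$ be a sequence in $X$ and $x\in X$. Then $(x_n)_n$ converges to $x$ if and only if all three limits $$\lim_{n\to\infty}p(x,x_n),\qquad \lim_{n\to\infty}p(x_n,x_n)\qquad\text{and}\qquad \lim_{n\to\infty}p(x_n,x)$$ exist and are equal to $p(x,x)$.
   Context: Here $\vee$ denotes the maximum (in the natural order) of elements of $[0,\infty]$. A generalised partial metric space $(X,p)$ is a set $X$ with a function $p\colon X\times X\to[0,\infty]$ such that $p(y,x)\ge p(x,x)\vee p(y,y)$ and $p(z,y)-p(y,y)+p(y,x)\ge p(z,x)$ for all $x,y,z\in X$. It is finitely typed if $p(x,x)<\infty$ for all $x\in X$ (but $p(x,y)=\infty$ is allowed for $x\neq y$). The categorical topology on a finitely typed generalised partial metric space is the topology given by the following (topological) closure operator: for $S\subseteq X$, $\overline{S}$ is the largest $T$ with $S\subseteq T\subseteq X$ such that $p(y,x)=\inf_{s\in S}\big(p(y,s)-p(s,s)+p(s,x)\big)$ for all $x,y\in T$; equivalently, $x\in\overline{S}$ iff $p(x,x)\ge\inf_{s\in S}\big(p(x,s)-p(s,s)+p(s,x)\big)$ (with $\inf\emptyset=\infty$). Convergence $(x_n)_n\to x$ means that every open set containing $x$ contains $x_n$ for all sufficiently large $n$. *)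

(* Defs.v *)
From HB Require Import structures.
From mathcomp Require Import all_boot all_order all_algebra.
From mathcomp Require Import all_classical all_reals all_analysis.
From mathcomp Require Import ring lra.
Set Implicit Arguments.
Unset Strict Implicit.
Unset Printing Implicit Defensive.
Import Order.TTheory GRing.Theory Num.Theory.
Local Open Scope classical_set_scope.
Local Open Scope ring_scope.
Local Open Scope ereal_scope.

(* p(y,s) - p(s,s) + p(s,x), where the subtraction is the truncated one of
   [0,+oo].  The truncation matters only when p s s = +oo: then p y s = +oo as
   well, and the library's convention +oo - +oo = -oo would be wrong there,
   whereas the truncated difference is 0. *)
Definition via (R : realType) (X : Type) (p : X -> X -> \bar R) (y s x : X) :
  \bar R := maxe 0 (p y s - p s s) + p s x.

Record gen_partial_metric (R : realType) (X : Type) (p : X -> X -> \bar R) :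
    Prop := GenPartialMetric {
  gpm_ge0 : forall x y, 0 <= p x y ;
  gpm_ge_self : forall x y, maxe (p x x) (p y y) <= p y x ;
  gpm_triangle : forall x y z, p z x <= via p z y x }.

Definition finitely_typed (R : realType) (X : Type) (p : X -> X -> \bar R) :
  Prop := forall x, p x x < +oo.

Definition cat_dense (R : realType) (X : Type) (p : X -> X -> \bar R)
    (S T : set X) : Prop :=
  S `<=` T /\
  forall x y, T x -> T y -> p y x = ereal_inf [set via p y s x | s in S].

(* The largest T in which S is categorically dense, defined as the union of
   all of them; that this union is itself one of them is
   [cat_closure_largest]. *)
Definition cat_closure (R : realType) (X : Type) (p : X -> X -> \bar R)
    (S : set X) : set X :=
  \bigcup_(T in [set T | cat_dense p S T]) T.

(* Carrier for the categorical topology: X itself, tagged with p. *)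
Definition cat_space (R : realType) (X : Type) (p : X -> X -> \bar R)
  (pm : gen_partial_metric p) (pf : finitely_typed p) : Type := X.

Section CatTopology.
Variables (R : realType) (X : Type) (p : X -> X -> \bar R).
Hypotheses (pm : gen_partial_metric p) (pf : finitely_typed p).
Implicit Types (x y z s : X) (S T : set X).

Lemma self_fin x : exists r : R, p x x = r%:E.
Proof.
have := pf x; have := gpm_ge0 pm x x.
by case: (p x x) => [r| |] // _ _; exists r.
Qed.

Lemma self_le_l x y : p x x <= p x y.
Proof. by have := gpm_ge_self pm y x; rewrite ge_max => /andP[]. Qed.

Lemma self_le_r x y : p y y <= p x y.
Proof. by have := gpm_ge_self pm y x; rewrite ge_max => /andP[]. Qed.

Lemma viaE y s x : via p y s x = p y s - p s s + p s x.
Proof.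
have [r rE] := self_fin s.
rewrite /via max_r // rE leeBrDr // add0e -rE; exact: self_le_r.
Qed.

Lemma viass s x : via p s s x = p s x.
Proof. by rewrite viaE; have [r ->] := self_fin s; rewrite subee // add0e. Qed.

Lemma gpm_lt_pinfty x y : p x y < +oo -> exists r : R, p x y = r%:E.
Proof.
have := gpm_ge0 pm x y.
by case: (p x y) => [r| |] // _ _; exists r.
Qed.

Lemma via_lt_fin y s x : via p y s x < +oo ->
  exists a b : R, p y s = a%:E /\ p s x = b%:E.
Proof.
rewrite viaE; have [r ->] := self_fin s.
have := gpm_ge0 pm y s; have := gpm_ge0 pm s x.
by case: (p y s) => [a| |] //; case: (p s x) => [b| |] // _ _ _; exists a, b.
Qed.

Lemma via_cat y x s e : p y x < +oo -> via p x s x < p x x + e%:E ->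
  via p y s x < p y x + e%:E.
Proof.
move=> /gpm_lt_pinfty[a yx] h.
have [q xx] := self_fin x; have [r ss] := self_fin s.
have [] := @via_lt_fin x s x.
  by rewrite (lt_trans h)// xx -EFinD ltry.
move=> b [c [xs sx]].
have t := gpm_triangle pm s x y; move: t h.
rewrite !viaE yx xx xs sx ss -!EFinB -!EFinD lte_fin.
have : 0 <= p y s := gpm_ge0 pm y s.
case: (p y s) => [d| |] //= _; rewrite -?EFinB -?EFinD ?lee_fin ?lte_fin //.
lra.
Qed.

Lemma cat_dense_inf S :
  cat_dense p S [set x | ereal_inf [set via p x s x | s in S] <= p x x].
Proof.
split=> [s Ss|x y xS yS].
  by apply: ereal_inf_lbound; exists s => //; rewrite viass.
apply/eqP; rewrite eq_le; apply/andP; split.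
  by apply/ereal_infP => _ [s _ <-]; exact: gpm_triangle.
have [->|/= yx] := eqVneq (p y x) +oo; first exact: leey.
apply/lee_addgt0Pr => e e0.
have [|_ [s Ss <-] h] :=
  @ereal_inf_lt R [set via p x s x | s in S] (p x x + e%:E).
  rewrite (le_lt_trans xS)//; have [q ->] := self_fin x.
  by rewrite -EFinD lte_fin ltrDl.
apply: ge_ereal_inf; exists (via p y s x); first by exists s.
by apply/ltW/via_cat => //; rewrite ltey.
Qed.

Lemma cat_closureE S :
  cat_closure p S = [set x | ereal_inf [set via p x s x | s in S] <= p x x].
Proof.
apply/seteqP; split=> [x [T [_ ST] Tx]|x xS] /=; first by rewrite -ST.
by eexists; [exact: cat_dense_inf|].
Qed.

Lemma cat_closure_largest S :
  cat_dense p S (cat_closure p S) /\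
  forall T, cat_dense p S T -> T `<=` cat_closure p S.
Proof.
by split=> [|T ST x Tx]; [rewrite cat_closureE; exact: cat_dense_inf|exists T].
Qed.

Lemma cat_closureP S x :
  cat_closure p S x <->
  forall e : R, (0 < e)%R -> exists2 s, S s & via p x s x < p x x + e%:E.
Proof.
rewrite cat_closureE /=; split=> [xS e e0|h].
  have [|_ [s Ss <-] ?] :=
    @ereal_inf_lt R [set via p x s x | s in S] (p x x + e%:E); last by exists s.
  by rewrite (le_lt_trans xS)//; have [q ->] := self_fin x;
    rewrite -EFinD lte_fin ltrDl.
apply/lee_addgt0Pr => e /h[s Ss /ltW hs].
by apply: ge_ereal_inf; exists (via p x s x) => //; exists s.
Qed.

Lemma sub_cat_closure S : S `<=` cat_closure p S.
Proof. by have [[]] := cat_closure_largest S. Qed.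

Lemma cat_closureS S T : S `<=` T -> cat_closure p S `<=` cat_closure p T.
Proof.
move=> ST x /cat_closureP h; apply/cat_closureP => e /h[s Ss hs].
by exists s => //; exact: ST.
Qed.

Lemma cat_closure0 : cat_closure p set0 = set0.
Proof.
by apply/seteqP; split=> // x /cat_closureP/(_ 1%R ltr01)[].
Qed.

Lemma cat_closureU S T :
  cat_closure p (S `|` T) = cat_closure p S `|` cat_closure p T.
Proof.
apply/seteqP; split=> [x /cat_closureP h|x []]; last 2 first.
- by apply: cat_closureS => y; left.
- by apply: cat_closureS => y; right.
apply: contrapT => /not_orP[].
move=> /cat_closureP/existsNP[e /not_implyP[e0 /forall2NP he]].
move=> /cat_closureP/existsNP[f /not_implyP[f0 /forall2NP hf]].
have [|s STs hs] := h (Num.min e f); first by rewrite lt_min e0 f0.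
have [q xx] := self_fin x.
case: STs => [Ss|Ts].
- case: (he s) => // /negP; rewrite -leNgt; apply/negP; rewrite -ltNge.
  by apply: (lt_le_trans hs); rewrite xx -!EFinD lee_fin lerD2l ge_min lexx.
- case: (hf s) => // /negP; rewrite -leNgt; apply/negP; rewrite -ltNge.
  by apply: (lt_le_trans hs);
    rewrite xx -!EFinD lee_fin lerD2l ge_min lexx orbT.
Qed.

Lemma cat_closureK S : cat_closure p (cat_closure p S) = cat_closure p S.
Proof.
apply/seteqP; split; last exact: sub_cat_closure.
move=> x /cat_closureP h; apply/cat_closureP => e e0.
have e20 : (0 < e / 2)%R by rewrite divr_gt0.
have [t /cat_closureP ht xtx] := h _ e20.
have [s Ss tst] := ht _ e20; exists s => //.
have [q xx] := self_fin x; have [r ss] := self_fin s.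
have [u tt] := self_fin t.
have [|a [b [xt tx]]] := @via_lt_fin x t x.
  by rewrite (lt_trans xtx)// xx -EFinD ltry.
have [|c [d [ts st]]] := @via_lt_fin t s t.
  by rewrite (lt_trans tst)// tt -EFinD ltry.
move: (gpm_triangle pm s t x) (gpm_triangle pm x t s) xtx tst.
rewrite !viaE xx ss tt xt tx ts st.
have := gpm_ge0 pm x s; have := gpm_ge0 pm s x.
case: (p x s) => [f| |] //=; case: (p s x) => [g| |] //= _ _;
  rewrite -?EFinB -?EFinD ?lee_fin ?lte_fin //; lra.
Qed.

Definition cat_open : set_system X :=
  [set U | cat_closure p (~` U) = ~` U].

Lemma cat_openT : cat_open setT.
Proof. by rewrite /cat_open /= setCT cat_closure0. Qed.

Lemma cat_openI : setI_closed cat_open.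
Proof.
by move=> U V; rewrite /cat_open /= setCI cat_closureU => -> ->.
Qed.

Lemma cat_open_bigU (I : Type) (f : I -> set X) :
  (forall i, cat_open (f i)) -> cat_open (\bigcup_i f i).
Proof.
move=> fo; rewrite /cat_open /=; apply/seteqP; split; last exact: sub_cat_closure.
rewrite setC_bigcup => x xf i _; rewrite -fo.
by apply: cat_closureS xf => y; exact.
Qed.

End CatTopology.

Section CatSpaceTopology.
Variables (R : realType) (X : Type) (p : X -> X -> \bar R).
Variables (pm : gen_partial_metric p) (pf : finitely_typed p).

HB.instance Definition _ := gen_eqMixin (cat_space pm pf).
HB.instance Definition _ := gen_choiceMixin (cat_space pm pf).
HB.instance Definition _ := isOpenTopological.Build (cat_space pm pf)
  (cat_openT pm pf) (cat_openI pm pf) (cat_open_bigU pm pf).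

Lemma cat_space_openE : @open (cat_space pm pf) = cat_open p.
Proof. by []. Qed.

Lemma cat_space_closedP (S : set (cat_space pm pf)) :
  closed S <-> cat_closure p S = S.
Proof.
rewrite -openC cat_space_openE /cat_open /=.
by have -> : ~` (~` S) = S by rewrite setCK.
Qed.

Lemma cat_space_closureE (S : set (cat_space pm pf)) :
  closure S = cat_closure p S.
Proof.
apply/seteqP; split=> x.
  rewrite closureE => /(_ (cat_closure p S)); apply; split.
    by apply/cat_space_closedP; exact: cat_closureK.
  exact: sub_cat_closure.
rewrite closureE => xS T [/cat_space_closedP TE ST].
by rewrite -TE; exact: (cat_closureS pm pf ST).
Qed.

End CatSpaceTopology.

(* Main.v *)
Require Import Defs.
From mathcomp Require Import all_boot all_order all_algebra.
From mathcomp Require Import all_classical all_reals all_analysis.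
From mathcomp Require Import lra.

(** Write v(s) for p(x,s) - p(s,s) + p(s,x), i.e. [via p x s x].  A point x lies
    in the closure of S exactly when v takes values below p(x,x) + e on S for
    every e > 0.  Applied to the complement of U, this says that U is a
    neighbourhood of x iff it contains some ball {s | v(s) < p(x,x) + e}
    ([nbhs_cat_spaceP]); hence a sequence converges to x iff v of it is
    eventually below p(x,x) + e, for each e > 0 ([cvg_cat_spaceP]).

    It remains to compare the size of v(s) with the three distances p(x,s),
    p(s,s) and p(s,x).  Since p(x,s) >= p(s,s), the smallness of v(s) bounds
    p(s,x) and, symmetrically, p(x,s) from above, and the axiom that
    self-distances are minimal supplies all the other bounds
    ([bounds_of_via]).  Conversely, v(s) is an alternating sum of the three
    distances, so it is close to p(x,x) as soon as each of them is
    ([via_of_bounds]). *)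

Import Order.TTheory GRing.Theory Num.Theory.
Local Open Scope classical_set_scope.
Local Open Scope ring_scope.
Local Open Scope ereal_scope.

(** Two-sided order bounds already force u i to be eventually finite, and this
    form combines directly with the inequalities of a partial metric, where
    p(x,s) may be infinite. *)
Lemma cvg_EFinP (R : realType) (I : Type) (F : set_system I) (FF : Filter F)
    (u : I -> \bar R) (r : R) :
  u i @[i --> F] --> r%:E <->
  forall e : R, (0 < e)%R ->
    \forall i \near F, (r - e)%:E < u i < (r + e)%:E.
Proof.
have boundsE (v : \bar R) (e : R) : (r - e)%:E < v < (r + e)%:E ->
    v \is a fin_num /\ (`|r - fine v| < e)%R.
  case: v => [v| |] //=; rewrite ?ltNyr ?andbF // !lte_fin => h; split => //.
  by rewrite ltr_norml; apply/andP; split; lra.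
split=> [/fine_cvgP[fin_u /cvgrPdist_lt cvg_u] e e0|h].
  near=> i.
  have : (`|r - fine (u i)| < e)%R by near: i; exact: cvg_u.
  have : u i \is a fin_num by near: i.
  case: (u i) => [v| |] //= _; rewrite ltr_norml => /andP[? ?].
  by rewrite !lte_fin; apply/andP; split; lra.
apply/fine_cvgP; split.
  by apply: filterS (h 1%R ltr01) => i /boundsE[].
by apply/cvgrPdist_lt => e /h; apply: filterS => i /boundsE[].
Unshelve. all: by end_near. Qed.

Section CatConvergence.
Context {R : realType} {X : Type} {p : X -> X -> \bar R}.
Context {pm : gen_partial_metric p} {pf : finitely_typed p}.

(** U is a neighbourhood of x iff x is outside the closure of the complement of
    U; the failure of the closure criterion yields a radius e. *)
Lemma nbhs_cat_spaceP (x : cat_space pm pf) (U : set (cat_space pm pf)) :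
  nbhs x U <->
  exists2 e : R, (0 < e)%R & forall s, via p x s x < p x x + e%:E -> U s.
Proof.
have -> : nbhs x U <-> ~ cat_closure p (~` U) x.
  rewrite -cat_space_closureE closure_setC.
  by split=> [? //|/contrapT].
rewrite cat_closureP//; split=> [/existsNP[e /not_implyP[e0 far]]|[e e0 ball_U]].
  exists e => // s hs; apply: contrapT => nUs.
  by apply: far; exists s.
by move=> /(_ e e0)[s nUs /ball_U].
Qed.

Lemma cvg_cat_spaceP (I : Type) (F : set_system I) (FF : Filter F)
    (u : I -> cat_space pm pf) (x : cat_space pm pf) :
  u i @[i --> F] --> x <->
  forall e : R, (0 < e)%R ->
    \forall i \near F, via p x (u i) x < p x x + e%:E.
Proof.
split=> [cvg_u e e0|h U /nbhs_cat_spaceP[e e0 ball_U]].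
  by apply: (cvg_u [set s | via p x s x < p x x + e%:E]);
    apply/nbhs_cat_spaceP; exists e.
by apply: filterS (h e e0) => i; exact: ball_U.
Qed.

(** Put a = p(x,s), r = p(s,s), b = p(s,x).  From a >= r, b >= r and a, b >= q,
    the inequality a - r + b < q + e gives b < q + e, a < q + e and
    a - r < e; then r <= a < q + e and r > a - e >= q - e. *)
Lemma bounds_of_via (x s : X) (q e : R) :
  p x x = q%:E -> via p x s x < (q + e)%:E ->
  [/\ (q - e)%:E < p x s < (q + e)%:E,
      (q - e)%:E < p s s < (q + e)%:E &
      (q - e)%:E < p s x < (q + e)%:E].
Proof.
move=> xx hs.
have [a [b [xs sx]]] := via_lt_fin pm pf (lt_trans hs (ltry _)).
have [r ss] := self_fin pm pf s.
move: (self_le_l pm x s) (self_le_r pm x s) (self_le_r pm s x)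
  (self_le_l pm s x) hs.
rewrite viaE// xx xs sx ss -EFinB -EFinD !lee_fin !lte_fin => *.
by split; apply/andP; split; lra.
Qed.

(** Each of the three terms of the alternating sum costs at most e. *)
Lemma via_of_bounds (x s : X) (q e : R) :
    (q - e)%:E < p x s < (q + e)%:E ->
    (q - e)%:E < p s s < (q + e)%:E ->
    (q - e)%:E < p s x < (q + e)%:E ->
  via p x s x < (q + e *+ 3)%:E.
Proof.
rewrite viaE//.
case: (p x s) (p s s) (p s x) => [a| |] // [r| |] // [b| |] //;
  rewrite ?ltNyr ?andbF //.
rewrite -EFinB -EFinD !lte_fin mulrS mulr2n; lra.
Qed.

End CatConvergence.

Theorem proposition5p2p3 (R : realType) (X : Type) (p : X -> X -> \bar R)
    (pm : gen_partial_metric p) (pf : finitely_typed p)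
    (x_ : nat -> cat_space pm pf) (x : cat_space pm pf) :
  x_ n @[n --> \oo] --> x <->
  [/\ p x (x_ n) @[n --> \oo] --> p x x,
      p (x_ n) (x_ n) @[n --> \oo] --> p x x &
      p (x_ n) x @[n --> \oo] --> p x x].
Proof.
have [q xx] := self_fin pm pf x.
rewrite cvg_cat_spaceP xx.
split=> [h|[/cvg_EFinP cvg_xs /cvg_EFinP cvg_ss /cvg_EFinP cvg_sx] e e0].
  by split; apply/cvg_EFinP => e /h; apply: filterS => n;
    rewrite -EFinD => /(bounds_of_via _ _ _ _ xx)[].
have e30 : (0 < e / 3)%R by rewrite divr_gt0.
have -> : q%:E + e%:E = (q + e / 3 *+ 3)%:E.
  by rewrite -EFinD -mulr_natr divfK.
apply: filterS3 (cvg_xs _ e30) (cvg_ss _ e30) (cvg_sx _ e30) => n.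
exact: via_of_bounds.
Qed.
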